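(* Let $p$ be a prime, $a\in\mathbb{Q}_p$ and $r\in\{p^m : m\in\mathbb{Z}\}$. (a) The pair $(V_r(a),\oplus)$, where $x\oplus y=x+y-a$ for $x,y\in V_r(a)$, is a compact topological abelian group. (b) The pair $(S_r(a),\odot)$, where $x\odot y=r(x-a)(y-a)+a$ for $x,y\in S_r(a)$, is a compact topological abelian group.
   Context: $\mathbb{Q}_p$ is the field of $p$-adic numbers with the $p$-adic norm $|\cdot|_p$ normalized by $|p|_p=p^{-1}$. $V_r(a)=\{x\in\mathbb{Q}_p : |x-a|_p\le r\}$ and $S_r(a)=\{x\in\mathbb{Q}_p : |x-a|_p=r\}$, with the subspace topology from $\mathbb{Q}_p$. In the formula for $\odot$, the rational number $r=p^m$ is regarded as an element of $\mathbb{Q}_p$ (so $|r|_p=1/r$). *)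

(* Defs.v *)
From HB Require Import structures.
From mathcomp Require Import all_boot all_order all_algebra.
From mathcomp Require Import generic_quotient ring_quotient.
From mathcomp Require Import all_classical topology normedtype.
From mathcomp Require Import zify.

Set Implicit Arguments.
Unset Strict Implicit.
Unset Printing Implicit Defensive.

Import Order.TTheory GRing.Theory Num.Theory.
Local Open Scope classical_set_scope.
Local Open Scope ring_scope.

Definition padic_val (p : nat) (q : rat) : int :=
  (logn p `|numq q|)%:Z - (logn p `|denq q|)%:Z.

Definition padic_abs (p : nat) (q : rat) : rat :=
  if q == 0 then 0 else p%:R ^ (- padic_val p q).

Section PadicAbs.
Variables (p : nat) (p_pr : prime p).
Implicit Types q r : rat.
Local Notation v := (padic_val p).
Local Notation abs := (padic_abs p).

Let p_gt0 : 0 < p%:R :> rat.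
Proof. by rewrite ltr0n prime_gt0. Qed.

Let p_neq0 : p%:R != 0 :> rat.
Proof. by rewrite gt_eqF. Qed.

Let p_ge1 : 1 <= p%:R :> rat.
Proof. by rewrite ler1n prime_gt0. Qed.

Lemma padic_val_frac (n d : int) : n != 0 -> d != 0 ->
  v (n%:~R / d%:~R) = (logn p `|n|)%:Z - (logn p `|d|)%:Z.
Proof.
move=> n0 d0; set q := n%:~R / d%:~R.
have q0 : q != 0 by rewrite mulf_neq0 ?invr_eq0 ?intr_eq0.
have qE : numq q * d = n * denq q.
  apply: (@intr_inj rat); rewrite !rmorphM /= numqE /q.
  by rewrite mulrAC divfK ?intr_eq0.
have := congr1 (fun z => logn p `|z|) qE; rewrite /= !abszM.
rewrite !lognM ?absz_gt0 ?numq_eq0 ?denq_eq0//.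
by rewrite /padic_val; lia.
Qed.

Lemma padic_abs0 : abs 0 = 0.
Proof. by rewrite /padic_abs eqxx. Qed.

Lemma padic_abs1 : abs 1 = 1.
Proof. 
by rewrite /padic_abs oner_eq0 /padic_val -[1]/1%:Q numq_int denq_int subrr. Qed.

Lemma padic_abs_gt0 q : (0 < abs q) = (q != 0).
Proof.
by rewrite /padic_abs; case: eqP => //= _; rewrite exprz_gt0.
Qed.

Lemma padic_abs_ge0 q : 0 <= abs q.
Proof. by rewrite /padic_abs; case: eqP => //= _; rewrite exprz_ge0 ?ltW. Qed.

Lemma padic_abs_eq0 q : (abs q == 0) = (q == 0).
Proof.
by apply/idP/idP => [|/eqP->]; rewrite ?padic_abs0//; apply: contraTT;
  rewrite -padic_abs_gt0 => /gt_eqF ->.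
Qed.

Lemma padic_valM q r : q != 0 -> r != 0 -> v (q * r) = v q + v r.
Proof.
move=> q0 r0; rewrite -{1}(divq_num_den q) -{1}(divq_num_den r).
rewrite mulf_div -!intrM padic_val_frac ?mulf_neq0 ?numq_eq0 ?denq_eq0//.
rewrite !abszM !lognM ?absz_gt0 ?numq_eq0 ?denq_eq0//.
by rewrite /padic_val; lia.
Qed.

Lemma padic_absM q r : abs (q * r) = abs q * abs r.
Proof.
have [->|q0] := eqVneq q 0; first by rewrite mul0r padic_abs0 mul0r.
have [->|r0] := eqVneq r 0; first by rewrite mulr0 padic_abs0 mulr0.
rewrite /padic_abs mulf_eq0 (negPf q0) (negPf r0) /= padic_valM//.
by rewrite opprD expfzDr.
Qed.

Lemma padic_absN q : abs (- q) = abs q.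
Proof. by rewrite /padic_abs /padic_val numqN denqN abszN oppr_eq0. Qed.

Lemma padic_abs_dist q r : abs (q - r) = abs (r - q).
Proof. by rewrite -padic_absN opprB. Qed.

Lemma padic_absV q : abs q^-1 = (abs q)^-1.
Proof.
have [->|q0] := eqVneq q 0; first by rewrite padic_abs0 !invr0 padic_abs0.
apply: (@mulfI _ (abs q)); first by rewrite padic_abs_eq0.
by rewrite -padic_absM !divff ?padic_abs1// padic_abs_eq0.
Qed.

Lemma padic_absD q r : abs (q + r) <= Num.max (abs q) (abs r).
Proof.
have [->|q0] := eqVneq q 0; first by rewrite add0r le_max lexx orbT.
have [->|r0] := eqVneq r 0; first by rewrite addr0 le_max lexx.
have [->|s0] := eqVneq (q + r) 0; first by rewrite padic_abs0 le_max padic_abs_ge0.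
rewrite le_max /padic_abs (negPf q0) (negPf r0) (negPf s0).
suff : (v q <= v (q + r)) || (v r <= v (q + r)).
  by case/orP => le_v; apply/orP; [left|right]; apply: ler_weXz2l => //; rewrite lerN2.
pose n1 := numq q * denq r; pose n2 := numq r * denq q.
pose d := denq q * denq r.
have d0 : d != 0 by rewrite mulf_neq0 ?denq_eq0.
have dq0 : denq q != 0 by rewrite denq_eq0.
have dr0 : denq r != 0 by rewrite denq_eq0.
have E1 : q = n1%:~R / d%:~R.
  by rewrite /n1 /d !rmorphM /= -mulf_div divff ?intr_eq0// mulr1 divq_num_den.
have E2 : r = n2%:~R / d%:~R.
  rewrite /n2 /d !rmorphM /= [(denq q)%:~R * _]mulrC -mulf_div divff ?intr_eq0//.
  by rewrite mulr1 divq_num_den.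
have Es : q + r = (n1 + n2)%:~R / d%:~R by rewrite rmorphD /= mulrDl -E1 -E2.
have n10 : n1 != 0 by rewrite mulf_neq0 ?numq_eq0.
have n20 : n2 != 0 by rewrite mulf_neq0 ?numq_eq0.
have n120 : n1 + n2 != 0.
  by apply: contraNneq s0 => n0; rewrite Es n0 mul0r.
rewrite Es E1 E2 !padic_val_frac// !lerD2r !lez_nat.
have dvd_ge k : (k <= logn p `|n1|)%N -> (k <= logn p `|n2|)%N ->
    (k <= logn p `|(n1 + n2)%R|)%N.
  move=> k1 k2; rewrite -pfactor_dvdn ?absz_gt0//.
  have -> : (p ^ k)%N = `|(p ^ k)%:Z|%N by [].
  by rewrite -dvdzE rpredD// dvdzE absz_nat pfactor_dvdn ?absz_gt0.
by case: (leqP (logn p `|n1|) (logn p `|n2|)) => h;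
  apply/orP; [left|right]; apply: dvd_ge => //; apply: ltnW.
Qed.

Lemma padic_absB q r s : abs (q - s) <= Num.max (abs (q - r)) (abs (r - s)).
Proof. by rewrite -(subrKA r); exact: padic_absD. Qed.

Lemma padic_absD_eq q r : abs r < abs q -> abs (q + r) = abs q.
Proof.
move=> rq; apply/eqP; rewrite eq_le; apply/andP; split.
  by apply: le_trans (padic_absD _ _) _; rewrite ge_max lexx ltW.
have := padic_absD (q + r) (- r); rewrite addrK padic_absN le_max.
by case/orP => //; rewrite leNgt rq.
Qed.

End PadicAbs.

Definition padic_cauchy (p : nat) : {pred nat -> rat} := fun u =>
  `[< forall e : rat, 0 < e -> exists N : nat, forall m n : nat,
      (N <= m)%N -> (N <= n)%N -> padic_abs p (u m - u n) < e >].

Section CauchyRing.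
Variables (p : nat) (p_pr : prime p).

Lemma padic_cauchyP (u : nat -> rat) : reflect
  (forall e : rat, 0 < e -> exists N : nat, forall m n : nat,
      (N <= m)%N -> (N <= n)%N -> padic_abs p (u m - u n) < e)
  (u \in padic_cauchy p).
Proof. exact: asboolP. Qed.

Lemma padic_cauchy_bounded (u : nat -> rat) : u \in padic_cauchy p ->
  exists2 M : rat, 0 < M & exists N : nat,
    forall n, (N <= n)%N -> padic_abs p (u n) <= M.
Proof.
move=> /padic_cauchyP/(_ 1 ltr01)[N cN].
exists (Num.max 1 (padic_abs p (u N))); first by rewrite lt_max ltr01.
exists N => n Nn; rewrite -(subrK (u N) (u n)).
apply: le_trans (padic_absD p_pr _ _) _.
by rewrite ge_max !le_max lexx orbT andbT ltW ?cN.
Qed.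

Lemma padic_cauchy_subring : subring_closed (padic_cauchy p).
Proof.
split.
- apply/padic_cauchyP => e e0; exists 0%N => m n _ _.
  by rewrite [X in padic_abs p X](_ : _ = 0) ?padic_abs0//; exact: subrr.
- move=> u w /padic_cauchyP cu /padic_cauchyP cw; apply/padic_cauchyP => e e0.
  have [N1 h1] := cu e e0; have [N2 h2] := cw e e0.
  exists (maxn N1 N2) => m n; rewrite !geq_max => /andP[m1 m2] /andP[n1 n2].
  have -> : (u - w) m - (u - w) n = (u m - u n) + (w n - w m).
    by rewrite !fctE opprB addrACA [RHS]addrACA; congr (_ + _); exact: addrC.
  by apply: le_lt_trans (padic_absD p_pr _ _) _; rewrite gt_max h1 ?h2//.
- move=> u w cu cw; have [M1 M10 [N1 b1]] := padic_cauchy_bounded cu.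
  have [M2 M20 [N2 b2]] := padic_cauchy_bounded cw.
  apply/padic_cauchyP => e e0.
  have /padic_cauchyP/(_ (e / M2))[|N3 c3] := cu; first exact: divr_gt0.
  have /padic_cauchyP/(_ (e / M1))[|N4 c4] := cw; first exact: divr_gt0.
  exists (maxn (maxn N1 N2) (maxn N3 N4)) => m n; rewrite !geq_max.
  move=> /andP[/andP[m1 m2] /andP[m3 m4]] /andP[/andP[n1 n2] /andP[n3 n4]].
  have -> : (u * w) m - (u * w) n = u m * (w m - w n) + (u m - u n) * w n.
    by rewrite mulrBr mulrBl subrKA.
  apply: le_lt_trans (padic_absD p_pr _ _) _; rewrite gt_max !padic_absM//.
  apply/andP; split.
    apply: le_lt_trans (_ : M1 * padic_abs p (w m - w n) < _).
      by rewrite ler_wpM2r ?padic_abs_ge0 ?b1.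
    by rewrite mulrC -ltr_pdivlMr// c4.
  apply: le_lt_trans (_ : padic_abs p (u m - u n) * M2 < _).
    by rewrite ler_wpM2l ?padic_abs_ge0 ?b2.
  by rewrite -ltr_pdivlMr// c3.
Qed.

End CauchyRing.

(* [p_pr] is a phantom parameter: it is part of the type so that the canonical
   instances, which all need [p] to be prime, can be inferred. *)
Record padic_cauchy_seq (p : nat) (p_pr : prime p) := PadicCauchySeq {
  cauchy_fun :> nat -> rat;
  _ : cauchy_fun \in padic_cauchy p }.

HB.instance Definition _ p (p_pr : prime p) :=
  [isSub for @cauchy_fun p p_pr].
HB.instance Definition _ p (p_pr : prime p) :=
  [Choice of padic_cauchy_seq p_pr by <:].
HB.instance Definition _ p (p_pr : prime p) :=
  GRing.SubChoice_isSubComNzRing.Build (nat -> rat) (padic_cauchy p)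
    (padic_cauchy_seq p_pr) (padic_cauchy_subring p_pr).

Definition padic_null (p : nat) (p_pr : prime p) :
    {pred padic_cauchy_seq p_pr} := fun u =>
  `[< forall e : rat, 0 < e -> exists N : nat, forall n : nat,
      (N <= n)%N -> padic_abs p (u n) < e >].
Arguments padic_null {p} p_pr.

Section NullIdeal.
Variables (p : nat) (p_pr : prime p).
Implicit Types u w : padic_cauchy_seq p_pr.

Lemma padic_nullP u : reflect
  (forall e : rat, 0 < e -> exists N : nat, forall n : nat,
      (N <= n)%N -> padic_abs p (u n) < e)
  (u \in padic_null p_pr).
Proof. exact: asboolP. Qed.

Lemma padic_null_ideal : idealr_closed (padic_null p_pr).
Proof.
split.
- apply/padic_nullP => e e0; exists 0%N => n _.
  by rewrite padic_abs0.
- apply/negP => /padic_nullP/(_ 1 ltr01)[N /(_ N (leqnn N))].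
  by rewrite padic_abs1 ltxx.
- move=> a u w /padic_nullP nu /padic_nullP nw; apply/padic_nullP => e e0.
  have [M M0 [N1 aM]] := padic_cauchy_bounded p_pr (valP a).
  have [|N2 h2] := nu (e / M); first exact: divr_gt0.
  have [N3 h3] := nw e e0.
  exists (maxn N1 (maxn N2 N3)) => n; rewrite !geq_max => /and3P[n1 n2 n3].
  have -> : (a * u + w) n = a n * u n + w n by [].
  apply: le_lt_trans (padic_absD p_pr _ _) _; rewrite gt_max h3// andbT.
  rewrite padic_absM//.
  apply: le_lt_trans (_ : M * padic_abs p (u n) < _).
    by rewrite ler_wpM2r ?padic_abs_ge0 ?aM.
  by rewrite mulrC -ltr_pdivlMr// h2.
Qed.

HB.instance Definition _ :=
  isIdealr.Build (padic_cauchy_seq p_pr) (padic_null p_pr) padic_null_ideal.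

End NullIdeal.

(* The completion of [rat] for [padic_abs p]. *)
Definition padic (p : nat) (p_pr : prime p) : Type :=
  {ideal_quot (padic_null p_pr)}.

HB.instance Definition _ p (p_pr : prime p) := GRing.ComNzRing.on (padic p_pr).
HB.instance Definition _ p (p_pr : prime p) := EqQuotient.on (padic p_pr).

Section PadicField.
Variables (p : nat) (p_pr : prime p).
Local Notation Qp := (padic p_pr).
Local Notation abs := (padic_abs p).
Local Open Scope quotient_scope.
Implicit Types (u w : padic_cauchy_seq p_pr) (x y z : Qp).

Lemma padic_pi_eq u w :
  (\pi_Qp u = \pi_Qp w) <-> (u - w \in padic_null p_pr).
Proof.
by rewrite Quotient.idealrBE; split=> [->//|/eqP].
Qed.

Lemma padic_pi0 : \pi_Qp 0 = 0.
Proof. exact: (@pi_zeror _ _ _ _ _ {ideal_quot (padic_null p_pr)}). Qed.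

Lemma padic_pi1 : \pi_Qp 1 = 1.
Proof.
by rewrite -[RHS](@pi_oner _ _ _ _ _ _ _ {ideal_quot (padic_null p_pr)}).
Qed.

Lemma padic_pi_eq0 u : (\pi_Qp u = 0) <-> (u \in padic_null p_pr).
Proof. by rewrite -padic_pi0 padic_pi_eq subr0. Qed.

Lemma padic_piD u w : \pi_Qp (u + w) = \pi_Qp u + \pi_Qp w.
Proof. exact: Quotient.pi_add. Qed.

Lemma padic_piN u : \pi_Qp (- u) = - \pi_Qp u.
Proof. exact: Quotient.pi_opp. Qed.

Lemma padic_piM u w : \pi_Qp (u * w) = \pi_Qp u * \pi_Qp w.
Proof. exact: Quotient.pi_mul. Qed.


Lemma padic_nonnull u : u \notin padic_null p_pr ->
  exists2 c, 0 < c & exists N : nat, forall n, (N <= n)%N -> abs (u n) = c.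
Proof.
move=> /padic_nullP/existsNP[e /not_implyP[e0 /forallNP nu]].
have /padic_cauchyP/(_ e e0)[N cN] := valP u.
have /existsNP[n0 /not_implyP[Nn0 /negP]] := nu N.
rewrite -leNgt => en0; exists (abs (u n0)); first exact: lt_le_trans en0.
exists n0 => n n0n; rewrite -(subrK (u n0) (u n)) addrC padic_absD_eq//.
by apply: lt_le_trans en0; apply: cN => //; exact: leq_trans n0n.
Qed.

(* The junk value 0 is used when [fun n => (u n)^-1] is not Cauchy, which can
   only happen if [u] is a null sequence. *)
Definition padic_seq_inv u : padic_cauchy_seq p_pr :=
  insubd 0 (fun n => (u n)^-1).

Lemma padic_seq_invE u : u \notin padic_null p_pr ->
  forall n, padic_seq_inv u n = (u n)^-1.
Proof.
move=> /padic_nonnull[c c0 [N1 uc]] n.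
rewrite /padic_seq_inv -[cauchy_fun _]/(val _) insubdK//.
apply/padic_cauchyP => e e0.
have /padic_cauchyP/(_ (e * (c * c)))[|N2 cu] := valP u.
  by rewrite !mulr_gt0.
exists (maxn N1 N2) => k l; rewrite !geq_max => /andP[k1 k2] /andP[l1 l2].
have uk0 : u k != 0 by rewrite -(padic_abs_gt0 p_pr) uc.
have ul0 : u l != 0 by rewrite -(padic_abs_gt0 p_pr) uc.
have -> : (u k)^-1 - (u l)^-1 = (u l - u k) / (u k * u l).
  by rewrite -[in LHS]div1r -[(u l)^-1]div1r -mulNr addf_div// mul1r mulN1r.
rewrite padic_absM// padic_absV// padic_absM// !uc// ltr_pdivrMr ?mulr_gt0//.
exact: cu.
Qed.

Definition padic_inv x : Qp :=
  if x == 0 then 0 else \pi_Qp (padic_seq_inv (repr x)).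

Lemma padic_inv0 : padic_inv 0 = 0.
Proof. by rewrite /padic_inv eqxx. Qed.

Lemma padic_mulVf x : x != 0 -> padic_inv x * x = 1.
Proof.
move=> x0; rewrite /padic_inv (negPf x0) -[X in _ * X]reprK -padic_piM.
have nu : repr x \notin padic_null p_pr.
  by apply: contra_neqN x0 => /padic_pi_eq0; rewrite reprK.
rewrite -padic_pi1; apply/padic_pi_eq/padic_nullP => e e0.
have [c c0 [N uc]] := padic_nonnull nu; exists N => n Nn.
have -> : (padic_seq_inv (repr x) * repr x - 1) n =
  padic_seq_inv (repr x) n * repr x n - 1 by [].
rewrite padic_seq_invE// mulVf ?subrr ?padic_abs0//.
by rewrite -(padic_abs_gt0 p_pr) uc.
Qed.

HB.instance Definition _ :=
  GRing.ComNzRing_isField.Build Qp padic_mulVf padic_inv0.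

(* For a Cauchy sequence the [p]-adic absolute values of the terms either
   tend to [0] or are eventually constant, so that the limit exists in [rat]. *)
Definition padic_norm x : rat :=
  lim ((fun n => abs (repr x n) : rat^o) @ \oo).

Lemma padic_norm_cst x u (c : rat) (N : nat) : 0 < c -> x = \pi_Qp u ->
  (forall n, (N <= n)%N -> abs (u n) = c) -> padic_norm x = c.
Proof.
move=> c0 xu uc.
have /padic_pi_eq/padic_nullP/(_ c c0)[N1 h1] : \pi_Qp (repr x) = \pi_Qp u.
  by rewrite reprK.
rewrite /padic_norm; apply: (@cvg_lim rat^o); first exact: metric_hausdorff.
apply: cvg_near_cst; exists (maxn N N1) => //= n /=.
rewrite geq_max => /andP[n1 n2].
rewrite -[repr x n](subrK (u n)) addrC padic_absD_eq ?uc//.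
exact: h1.
Qed.

Lemma padic_norm0 : padic_norm 0 = 0.
Proof.
have /padic_nullP nu : repr (0 : Qp) \in padic_null p_pr.
  by apply/padic_pi_eq0; rewrite reprK.
rewrite /padic_norm; apply: (@cvg_lim rat^o); first exact: metric_hausdorff.
apply/cvgrPdist_lt => /= e e0; have [N hN] := nu e e0.
exists N => //= n /= Nn.
by rewrite sub0r normrN ger0_norm ?padic_abs_ge0//; exact: hN.
Qed.

Lemma padic_normE x : x != 0 -> exists u c (N : nat),
  [/\ 0 < c, x = \pi_Qp u, forall n, (N <= n)%N -> abs (u n) = c
    & padic_norm x = c].
Proof.
move=> x0; have /padic_nonnull[c c0 [N uc]] : repr x \notin padic_null p_pr.
  by apply: contra_neqN x0 => /padic_pi_eq0; rewrite reprK.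
exists (repr x), c, N; split=> //; first by rewrite reprK.
by apply: padic_norm_cst uc => //; rewrite reprK.
Qed.

Lemma padic_norm_gt0 x : (0 < padic_norm x) = (x != 0).
Proof.
have [->|x0] := eqVneq x 0; first by rewrite padic_norm0 ltxx.
by have [u [c [N [c0 _ _ ->]]]] := padic_normE x0.
Qed.

Lemma padic_norm_ge0 x : 0 <= padic_norm x.
Proof.
by have [->|x0] := eqVneq x 0; rewrite ?padic_norm0// ltW// padic_norm_gt0.
Qed.

Lemma padic_norm_eq0 x : (padic_norm x == 0) = (x == 0).
Proof.
have [->|x0] := eqVneq x 0; first by rewrite padic_norm0 eqxx.
by rewrite gt_eqF// padic_norm_gt0.
Qed.

Lemma padic_normM x y : padic_norm (x * y) = padic_norm x * padic_norm y.
Proof.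
have [->|x0] := eqVneq x 0; first by rewrite mul0r padic_norm0 mul0r.
have [->|y0] := eqVneq y 0; first by rewrite mulr0 padic_norm0 mulr0.
have [u [c [N1 [c0 xu uc ->]]]] := padic_normE x0.
have [w [d [N2 [d0 yw wd ->]]]] := padic_normE y0.
apply: (@padic_norm_cst _ (u * w) _ (maxn N1 N2)).
- exact: mulr_gt0.
- by rewrite padic_piM xu yw.
- move=> n; rewrite geq_max => /andP[n1 n2].
  by rewrite -[(u * w) n]/(u n * w n) padic_absM// uc// wd.
Qed.

Lemma padic_norm1 : padic_norm 1 = 1.
Proof.
apply: (@padic_norm_cst _ 1 _ 0%N) => //; first by rewrite padic_pi1.
by move=> n _; rewrite padic_abs1.
Qed.

Lemma padic_normV x : padic_norm x^-1 = (padic_norm x)^-1.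
Proof.
have [->|x0] := eqVneq x 0; first by rewrite padic_norm0 !invr0 padic_norm0.
apply: (@mulfI _ (padic_norm x)); first by rewrite padic_norm_eq0.
by rewrite -padic_normM !divff ?padic_norm1// padic_norm_eq0.
Qed.

Lemma padic_normN x : padic_norm (- x) = padic_norm x.
Proof.
have [->|x0] := eqVneq x 0; first by rewrite oppr0.
have [u [c [N [c0 xu uc ->]]]] := padic_normE x0.
apply: (@padic_norm_cst _ (- u) _ N) => //; first by rewrite padic_piN xu.
by move=> n Nn; rewrite -[(- u) n]/(- (u n)) padic_absN uc.
Qed.

Lemma padic_norm_dist x y : padic_norm (x - y) = padic_norm (y - x).
Proof. by rewrite -padic_normN opprB. Qed.

Lemma padic_normD_max x y :
  padic_norm (x + y) <= Num.max (padic_norm x) (padic_norm y).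
Proof.
have [->|x0] := eqVneq x 0; first by rewrite add0r le_max lexx orbT.
have [->|y0] := eqVneq y 0; first by rewrite addr0 le_max lexx.
have [->|s0] := eqVneq (x + y) 0.
  by rewrite padic_norm0 le_max padic_norm_ge0.
have [u [c [N1 [c0 xu uc ->]]]] := padic_normE x0.
have [w [d [N2 [d0 yw wd ->]]]] := padic_normE y0.
have [t [e [N3 [e0 st te ->]]]] := padic_normE s0.
have uwt : \pi_Qp (u + w) = \pi_Qp t by rewrite padic_piD -xu -yw.
have /padic_pi_eq/padic_nullP/(_ e e0)[N4 h4] := esym uwt.
pose n := maxn (maxn N1 N2) (maxn N3 N4).
have [n1 n2 n3 n4] : [/\ N1 <= n, N2 <= n, N3 <= n & N4 <= n]%N.
  by rewrite /n; split; lia.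
rewrite -(uc n)// -(wd n)// -(te n n3).
apply: le_trans (padic_absD p_pr _ _).
have := padic_absD p_pr (t n - (u n + w n)) (u n + w n).
rewrite subrK le_max => /orP[|//].
by rewrite leNgt te// (h4 n n4).
Qed.

Lemma padic_normD x y : padic_norm (x + y) <= padic_norm x + padic_norm y.
Proof.
apply: le_trans (padic_normD_max x y) _.
by rewrite ge_max lerDl lerDr !padic_norm_ge0.
Qed.

Lemma padic_norm_int (m : int) : padic_norm m%:~R = abs m%:~R.
Proof.
have pi_nat k : \pi_Qp k%:R = k%:R.
  by elim: k => [|k IH]; rewrite ?padic_pi0// !mulrS padic_piD IH padic_pi1.
have pi_int : \pi_Qp m%:~R = m%:~R.
  case: m => k; first by rewrite -!pmulrn pi_nat.
  by rewrite NegzE !mulrNz padic_piN -!pmulrn pi_nat.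
have cst n : (m%:~R : padic_cauchy_seq p_pr) n = m%:~R.
  have cst_nat k : (k%:R : padic_cauchy_seq p_pr) n = k%:R.
    by elim: k => // k IH; rewrite !mulrS -[LHS]/(1 + (k%:R : padic_cauchy_seq p_pr) n) IH.
  clear pi_int; case: m => k; first by rewrite -!pmulrn cst_nat.
  by rewrite NegzE !mulrNz -[LHS]/(- ((k.+1%:~R : padic_cauchy_seq p_pr) n)) -!pmulrn cst_nat.
have [m0|m0] := eqVneq m 0; first by rewrite m0 padic_abs0 padic_norm0.
apply: (@padic_norm_cst _ m%:~R _ 0%N); rewrite ?padic_abs_gt0 ?intr_eq0//.
by move=> n _; rewrite cst.
Qed.

Lemma padic_norm_ratr (q : rat) : padic_norm (ratr q) = abs q.
Proof.
rewrite /ratr padic_normM padic_normV !padic_norm_int.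
by rewrite -padic_absV// -padic_absM// divq_num_den.
Qed.

Definition padic_dist x y : rat := padic_norm (x - y).

Lemma padic_distxx x : padic_dist x x = 0.
Proof. by rewrite /padic_dist subrr padic_norm0. Qed.

Lemma padic_dist_eq0 x y : padic_dist x y = 0 -> x = y.
Proof. by move=> /eqP; rewrite padic_norm_eq0 subr_eq0 => /eqP. Qed.

Lemma padic_dist_sym x y : padic_dist x y = padic_dist y x.
Proof. exact: padic_norm_dist. Qed.

Lemma padic_dist_triangle y x z :
  padic_dist x z <= padic_dist x y + padic_dist y z.
Proof. by rewrite /padic_dist -(subrKA y); exact: padic_normD. Qed.

HB.instance Definition _ := isMetric.Build rat Qp
  padic_distxx padic_dist_eq0 padic_dist_sym padic_dist_triangle.

End PadicField.

Definition padic_ball (p : nat) (p_pr : prime p) (r : rat) (a : padic p_pr) :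
    set (padic p_pr) :=
  [set x | padic_norm (x - a) <= r].

Definition padic_sphere (p : nat) (p_pr : prime p) (r : rat) (a : padic p_pr) :
    set (padic p_pr) :=
  [set x | padic_norm (x - a) = r].

Definition topological_abelian_group (T : topologicalType) (op : T -> T -> T) :
    Prop :=
  [/\ associative op, commutative op,
      continuous (fun xy : T * T => op xy.1 xy.2) &
      exists (e : T) (inv : T -> T),
        [/\ left_id e op, left_inverse e inv op & continuous inv]].

Definition compact_topological_abelian_group (T : topologicalType)
    (op : T -> T -> T) : Prop :=
  topological_abelian_group op /\ compact [set: T].

(* Main.v *)
Require Import Defs.
From mathcomp Require Import all_boot all_order all_algebra.
From mathcomp Require Import all_classical topology.
From mathcomp Require Import ring.
Set Implicit Arguments.
Unset Strict Implicit.
Unset Printing Implicit Defensive.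
Import Order.TTheory GRing.Theory Num.Theory.
Local Open Scope classical_set_scope.
Local Open Scope ring_scope.

(** Both group structures live on a subset of [Q_p] that is compact, and both
are given by maps that do not increase distances.

Compactness of the ball of radius [p ^ m] is the digit expansion, read through
ultrafilters.  A ball of radius [p ^ m] is a union of [p] balls of radius
[p ^ (m - 1)], one for each leading digit ([padic_ball_cover], which rests on
the fact that a rational of absolute value at most 1 is congruent modulo [p]
to one of [0, ..., p - 1], [padic_residue]).  An ultrafilter containing the
ball therefore contains one of the smaller balls, and inductively a ball of
radius [p ^ (m - n)] for every [n] ([padic_ultra_small_ball]).  The centers can
be taken rational, and two balls of the ultrafilter meet, so the ultrametric
inequality makes the centers a Cauchy sequence of rationals; the class of this
sequence lies in all the balls ([padic_nested_balls]) and is a limit of the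
ultrafilter.  The sphere is compact because it is closed in the ball.

For the group laws, the translation by [a] turns the ball into an additive
subgroup and the sphere into the set of [u] with [|u| = r].  On the latter the
law is [R * u * v], where [R] is the image of [r] in [Q_p]; since [|R| = 1 / r],
multiplication by [R] brings this set onto the group of units [|u| = 1] and the
law to the product.  Hence the identity is [R^-1] and the inverse of [u] is
[R^-2 * u^-1].  The ultrametric inequality shows that each law has
[|x * y - x' * y'| <= max (|x - x'|, |y - y'|)] and that each inverse is an
isometry, which is more than continuity
([nonexpansive_topological_group]). *)

(** * Filters *)

Lemma filter_meet (T : Type) (F : set_system T) (A B : set T) :
  ProperFilter F -> F A -> F B -> exists x, A x /\ B x.
Proof. by move=> PF FA FB; apply: filter_ex (filterI FA FB). Qed.

Lemma ultra_bigcup_fin (T : Type) (I : finType) (F : set_system T)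
    (B : I -> set T) :
  UltraFilter F -> F (\bigcup_i B i) -> exists i, F (B i).
Proof.
move=> UF FB; apply: contrapT => /forallNP nF.
have /filter_ex[x [[i _ Bx] nx]] :
    F (\bigcup_i B i `&` [set x | forall i, (~` B i) x]).
  apply: filterI FB _; apply: filter_forall => i.
  by have [/nF|] := in_ultra_setVsetC (B i) UF.
exact: nx Bx.
Qed.

(** * Rational approximation in the p-adic numbers *)

Section PadicCompactness.
Context (p : nat) (p_pr : prime p).
Local Notation Qp := (padic p_pr).
Local Notation abs := (padic_abs p).
Local Notation norm := (@padic_norm p p_pr).
Local Open Scope quotient_scope.
Implicit Types (x y z : Qp) (q s : rat) (u w : padic_cauchy_seq p_pr).

Lemma padic_const_cauchy q : (fun=> q) \in padic_cauchy p.
Proof.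
by apply/padic_cauchyP => e e0; exists 0%N => m n _ _; rewrite subrr padic_abs0.
Qed.

(** The same embedding as [ratr], in the form of a constant sequence: this is
the form in which norms of differences are computed term by term. *)
Definition padic_of_rat q : Qp :=
  \pi_Qp (PadicCauchySeq p_pr (padic_const_cauchy q)).

Lemma padic_piB u w : \pi_Qp u - \pi_Qp w = \pi_Qp (u - w).
Proof. by rewrite padic_piD padic_piN. Qed.

(** A bound on the terms passes to the norm because the absolute values of the
terms are eventually equal to the norm, unless the class is zero. *)
Lemma padic_norm_pi_le u (c : rat) (N : nat) : 0 <= c ->
  (forall n, (N <= n)%N -> abs (u n) <= c) -> norm (\pi_Qp u) <= c.
Proof.
move=> c0 uc; have [u0|/negP nu] := pselect (u \in padic_null p_pr).
  by have /padic_pi_eq0 -> := u0; rewrite padic_norm0.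
have [d d0 [M ud]] := padic_nonnull nu.
rewrite (padic_norm_cst d0 (erefl _) ud) -(ud (maxn M N)) ?leq_maxl//.
exact/uc/leq_maxr.
Qed.

Lemma padic_norm_pi_sub_le u q (c : rat) (N : nat) : 0 <= c ->
  (forall n, (N <= n)%N -> abs (u n - q) <= c) ->
  norm (\pi_Qp u - padic_of_rat q) <= c.
Proof.
move=> c0 uc; rewrite /padic_of_rat padic_piB.
apply: (padic_norm_pi_le (N := N) c0) => n Nn.
rewrite -[(u - _) n]/(u n - q).
exact: uc.
Qed.

Lemma padic_of_rat_dist q s :
  norm (padic_of_rat q - padic_of_rat s) = abs (q - s).
Proof.
have [->|qs] := eqVneq q s; first by rewrite !subrr padic_norm0 padic_abs0.
rewrite /padic_of_rat padic_piB.
apply: (@padic_norm_cst _ _ _ _ _ 0%N _ (erefl _)).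
  by rewrite padic_abs_gt0// subr_eq0.
by [].
Qed.

(** Being at distance at most [c] is transitive, by the ultrametric inequality:
two balls of radius [c] that meet are equal. *)
Lemma padic_norm_sub_trans (c : rat) y x z :
  norm (x - y) <= c -> norm (y - z) <= c -> norm (x - z) <= c.
Proof.
move=> xy yz; rewrite -(subrKA y); apply: le_trans (padic_normD_max _ _) _.
by rewrite ge_max xy.
Qed.

Lemma padic_rat_dense x (e : rat) : 0 < e ->
  exists q, norm (x - padic_of_rat q) <= e.
Proof.
move=> e0; have /padic_cauchyP/(_ e e0)[N cN] := valP (repr x).
exists (repr x N); rewrite -[X in X - _]reprK.
apply: (@padic_norm_pi_sub_le _ _ _ N) => [|n Nn]; first exact: ltW.
exact/ltW/cN.
Qed.

(** Write [q = n / d] in lowest terms: [|q| <= 1] says that [p] does not divide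
[d], so that [d] is invertible modulo [p], and [k] is [n * d^-1] modulo [p]. *)
Lemma padic_residue q : abs q <= 1 ->
  exists k : 'I_p, abs (q - (k : nat)%:R) <= p%:R^-1.
Proof.
move=> q1; have p0 : 0 < p%:R :> rat by rewrite ltr0n prime_gt0.
have [->|q0] := eqVneq q 0.
  by exists (Ordinal (prime_gt0 p_pr)); rewrite subrr padic_abs0 invr_ge0 ltW.
have pd : coprime `|denq q| p.
  rewrite coprime_sym prime_coprime//; apply/negP => pd.
  have pn : ~~ (p %| `|numq q|)%N.
    rewrite -prime_coprime// coprime_sym.
    by apply: coprime_dvdr (coprime_num_den q); rewrite ?absz_nat.
  move: q1; rewrite /padic_abs (negPf q0) leNgt => /negP; apply.
  rewrite /padic_val lognE (negPf pn) !andbF sub0r opprK.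
  rewrite -exprnP exprn_egt1// ?ltr1n ?prime_gt1//.
  by rewrite -lt0n logn_gt0 mem_primes p_pr pd absz_gt0 denq_eq0.
(* [w] is an inverse of the denominator modulo [p]. *)
have [[w v]] := coprimezP (denq q) p%:Z pd; rewrite /= => wv.
pose k := (numq q * w %% p%:Z)%Z.
have k0 : 0 <= k by rewrite modz_ge0// eqz_nat -lt0n prime_gt0.
have kE : k = `|k|%N%:Z by rewrite gez0_abs.
have kp : (`|k| < p)%N.
  by rewrite -ltz_nat -kE ltz_pmod// ltz_nat prime_gt0.
exists (Ordinal kp) => /=.
have -> : `|k|%N%:R = k%:~R :> rat by rewrite [in RHS]kE.
have [z zE] : exists z : int, numq q - k * denq q = z * p%:Z.
  exists (numq q * v + (numq q * w %/ p%:Z)%Z * denq q).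
  have -> : k = numq q * w - (numq q * w %/ p%:Z)%Z * p%:Z.
    by rewrite {1}(divz_eq (numq q * w) p%:Z) addrAC subrr add0r.
  by rewrite -{1}[numq q]mulr1 -wv; ring.
(* [k] must be opaque: [rmorphB] would see the difference hidden in [modz]. *)
clearbody k.
have -> : q - k%:~R = (z * p%:Z)%:~R / (denq q)%:~R.
  rewrite -zE rmorphB rmorphM /= mulrBl mulfK ?intr_eq0 ?denq_eq0//.
  by rewrite divq_num_den.
have [->|z0] := eqVneq z 0.
  by rewrite mul0r padic_abs0 invr_ge0 ltW.
have zp0 : z * p%:Z != 0 by rewrite mulf_neq0// eqz_nat -lt0n prime_gt0.
rewrite /padic_abs ifF; last first.
  by apply/negbTE; rewrite mulf_neq0 ?invr_eq0 ?intr_eq0 ?denq_eq0.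
rewrite padic_val_frac ?denq_eq0// abszM absz_nat lognM ?absz_gt0 ?prime_gt0//.
have -> : logn p `|denq q| = 0%N.
  apply/eqP; rewrite -leqn0 leqNgt logn_gt0 mem_primes p_pr absz_gt0 denq_eq0.
  by rewrite -prime_coprime// coprime_sym pd.
rewrite (logn_prime p p_pr) eqxx subr0 -exprN1; apply: ler_weXz2l.
  by rewrite ler1n prime_gt0.
by rewrite lerN2 lez_nat addn1.
Qed.

Lemma padic_abs_exp (m : int) : abs (p%:R ^ m) = p%:R ^ (- m).
Proof.
have abs_nat n : abs (p%:R ^+ n) = p%:R ^- n.
  elim: n => [|n IH]; first by rewrite expr0 padic_abs1 invr1.
  rewrite exprS padic_absM// IH invfM; congr (_ * _).
  have p0 : p%:Z != 0 by rewrite eqz_nat -lt0n prime_gt0.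
  rewrite -[p%:R]divr1 /padic_abs ifF.
    rewrite -[p%:R]/(p%:Z%:~R) -[1]/(1%:~R) padic_val_frac//.
    by rewrite absz_nat logn1 (logn_prime p p_pr) eqxx subr0 divr1.
  by apply/negbTE; rewrite divr1 pnatr_eq0 -lt0n prime_gt0.
case: m => n; first by rewrite -exprnP abs_nat -exprnN.
by rewrite NegzE opprK -exprnN padic_absV// abs_nat invrK.
Qed.

(** Replacing the point by a rational [s] at distance at most [p ^ (m - 1)],
the digit [k] is the residue of [(s - q) * p ^ m], which has absolute value at
most 1. *)
Lemma padic_ball_cover (m : int) q :
  padic_ball (p%:R ^ m) (padic_of_rat q) `<=`
  \bigcup_(k : 'I_p)
    padic_ball (p%:R ^ (m - 1)) (padic_of_rat (q + (k : nat)%:R * p%:R ^ (- m))).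
Proof.
move=> x xq; have p0 : 0 < p%:R :> rat by rewrite ltr0n prime_gt0.
have pm0 : p%:R ^ m != 0 :> rat by rewrite expfz_neq0// gt_eqF.
have [s xs] := padic_rat_dense x (exprz_gt0 (m - 1) p0).
have le_p : p%:R ^ (m - 1) <= p%:R ^ m :> rat.
  by apply: ler_weXz2l; [rewrite ler1n prime_gt0 | rewrite gerBl].
have sq : abs ((s - q) * p%:R ^ m) <= 1.
  rewrite padic_absM// padic_abs_exp -invr_expz ler_pdivrMr ?exprz_gt0// mul1r.
  rewrite -padic_of_rat_dist; apply: (@padic_norm_sub_trans _ x) => //.
  by rewrite padic_norm_dist (le_trans xs le_p).
have [k kE] := padic_residue sq; exists k => //.
apply: (padic_norm_sub_trans xs); rewrite padic_of_rat_dist.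
have -> : s - (q + (k : nat)%:R * p%:R ^ (- m)) =
    ((s - q) * p%:R ^ m - (k : nat)%:R) * p%:R ^ (- m).
  by rewrite mulrBl -invr_expz mulfK//; ring.
rewrite padic_absM// padic_abs_exp opprK expfzDr ?gt_eqF// exprN1 [leRHS]mulrC.
by apply: ler_wpM2r kE; rewrite exprz_ge0 ?ltW.
Qed.

(** * Compactness of balls and spheres *)

Lemma prime_exp_lt (m : int) (e : rat) : 0 < e ->
  exists n : nat, p%:R ^ (m - n%:Z) < e.
Proof.
move=> e0; have p0 : 0 < p%:R :> rat by rewrite ltr0n prime_gt0.
have me0 : 0 <= p%:R ^ m / e by rewrite divr_ge0 ?exprz_ge0 ?ltW.
exists (Num.Def.archi_bound (p%:R ^ m / e)).
set n := Num.Def.archi_bound _.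
rewrite expfzDr ?gt_eqF// -invr_expz ltr_pdivrMr ?exprz_gt0//.
rewrite mulrC -ltr_pdivrMr//; apply: lt_trans (archi_boundP me0) _.
by rewrite -exprnP -natrX ltr_nat ltn_expl ?prime_gt1.
Qed.

(** Completeness, for balls with rational centers: the sequence of the centers
is itself a representative of the common point. *)
Lemma padic_nested_balls (m : int) (q : nat -> rat) :
  (forall n k : nat, (n <= k)%N -> abs (q k - q n) <= p%:R ^ (m - n%:Z)) ->
  exists x, forall n, padic_ball (p%:R ^ (m - n%:Z)) (padic_of_rat (q n)) x.
Proof.
move=> qc; have p0 : 0 < p%:R :> rat by rewrite ltr0n prime_gt0.
have cq : q \in padic_cauchy p.
  apply/padic_cauchyP => e e0; have [N Ne] := prime_exp_lt m e0.
  exists N => i j Ni Nj; rewrite -(subrKA (q N)).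
  apply: le_lt_trans (padic_absD p_pr _ _) _.
  rewrite gt_max (le_lt_trans (qc _ _ Ni))//= padic_abs_dist.
  exact: le_lt_trans (qc _ _ Nj) Ne.
exists (\pi_Qp (PadicCauchySeq p_pr cq)) => n.
apply: (@padic_norm_pi_sub_le _ _ _ n) => [|k nk]; last exact: qc.
by rewrite exprz_ge0 ?ltW.
Qed.

Lemma padic_ultra_small_ball (F : set_system Qp) (m : int) (a : Qp) :
  UltraFilter F -> F (padic_ball (p%:R ^ m) a) ->
  forall n : nat, exists q, F (padic_ball (p%:R ^ (m - n%:Z)) (padic_of_rat q)).
Proof.
move=> UF Fa; elim=> [|n [q Fq]].
  have p0 : 0 < p%:R :> rat by rewrite ltr0n prime_gt0.
  have [q aq] := padic_rat_dense a (exprz_gt0 m p0).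
  exists q; rewrite subr0; apply: filterS Fa => x xa.
  exact: padic_norm_sub_trans xa aq.
have [k Fk] := ultra_bigcup_fin UF (filterS (@padic_ball_cover _ _) Fq).
exists (q + (k : nat)%:R * p%:R ^ (- (m - n%:Z))).
by rewrite -addn1 PoszD opprD addrA.
Qed.

Lemma padic_ball_compact (m : int) (a : Qp) : compact (padic_ball (p%:R ^ m) a).
Proof.
rewrite compact_ultra => F UF Fa.
have [q qF] := choice (padic_ultra_small_ball UF Fa).
have [|x xq] := @padic_nested_balls m q.
  move=> n k nk; rewrite -padic_of_rat_dist.
  have [y [yn yk]] := filter_meet _ (qF n) (qF k).
  apply: padic_norm_sub_trans yn; rewrite padic_norm_dist; apply: le_trans yk _.
  apply: ler_weXz2l; first by rewrite ler1n prime_gt0.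
  by rewrite lerD2l lerN2 lez_nat.
exists x; split.
  have [y [ya yq]] := filter_meet _ Fa (qF 0%N).
  move: (xq 0%N) yq; rewrite subr0 => x0 y0.
  apply: padic_norm_sub_trans ya; apply: (padic_norm_sub_trans x0).
  by rewrite padic_norm_dist.
move=> U /nbhs_ballP[e /= e0 xU].
have [n ne] := prime_exp_lt m e0.
apply: filterS (qF n) => y yq; apply: xU.
rewrite ballEmdist /=; apply: le_lt_trans ne.
by apply: (padic_norm_sub_trans (xq n)); rewrite padic_norm_dist.
Qed.

(** Every triangle is isosceles, so the norm is locally constant away from 0;
this makes spheres open and closed. *)
Lemma padic_norm_eq_near (r : rat) (a : Qp) x y :
  norm (x - y) < r -> norm (y - a) = r -> norm (x - a) = r.
Proof.
move=> xy ya; apply/eqP; rewrite eq_le; apply/andP; split.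
  by apply: (@padic_norm_sub_trans _ y); rewrite ?ya // ltW.
have := padic_normD_max (y - x) (x - a); rewrite subrKA ya le_max.
by rewrite padic_norm_dist leNgt xy.
Qed.

Lemma padic_sphere_closed (r : rat) (a : Qp) : 0 < r -> closed (padic_sphere r a).
Proof.
move=> r0 x xr; have [|y [ya]] := xr (ball x r); first exact: nbhsx_ballx.
by rewrite ballEmdist /= => xy; exact: padic_norm_eq_near xy ya.
Qed.

Lemma padic_sphere_compact (m : int) (a : Qp) :
  compact (padic_sphere (p%:R ^ m) a).
Proof.
apply: (subclosed_compact _ (@padic_ball_compact m a)).
  by apply: padic_sphere_closed; rewrite exprz_gt0 ?ltr0n ?prime_gt0.
by move=> x xa; rewrite /padic_ball /= xa.
Qed.

End PadicCompactness.

(** * Topological groups on subsets *)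

Lemma compact_set_type (X : topologicalType) (A : set X) :
  compact A -> compact [set: A].
Proof.
move=> cA F PF _.
have [|x [Ax xF]] := cA ((set_val : A -> X) @ F).
  by apply: (@filterS _ F _ setT) => [x _|]; [exact: set_valP | exact: filterT].
exists (exist _ x (mem_set Ax)); split=> // U V FU [_ [[B oB <-] Bx BV]].
have [||y [[z Uz <-] By]] := xF [set set_val z | z in U] B.
- by apply: (@filterS _ F _ U) FU => z Uz; exists z.
- exact: open_nbhs_nbhs.
by exists z; split=> //; exact: BV.
Qed.

(** The subset topology is generated by the balls of the ambient space centered
at points of the subset. *)
Lemma nbhs_set_type_ballP (R : numFieldType) (T : pseudoMetricType R)
    (A : set T) (x : A) (U : set A) :
  nbhs x U <->
  exists2 d, 0 < d & forall y : A, ball (set_val x) d (set_val y) -> U y.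
Proof.
split=> [[_ [[B oB <-] Bx BU]]|[d d0 dU]].
  have /nbhs_ballP[d /= d0 dB] := open_nbhs_nbhs (conj oB Bx).
  by exists d => // y xy; apply: BU; exact: dB.
have : nbhs x (set_val @^-1` ball (set_val x) d).
  by apply: initial_continuous; exact: nbhsx_ballx.
exact: filterS.
Qed.

Lemma nonexpansive_topological_group (R : numFieldType) (T : pseudoMetricType R)
    (A : set T) (op : A -> A -> A) (e : A) (inv : A -> A) :
  associative op -> commutative op -> left_id e op -> left_inverse e inv op ->
  (forall d (x x' y y' : A),
    ball (set_val x) d (set_val x') -> ball (set_val y) d (set_val y') ->
    ball (set_val (op x y)) d (set_val (op x' y'))) ->
  (forall d (x y : A),
    ball (set_val x) d (set_val y) -> ball (set_val (inv x)) d (set_val (inv y))) ->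
  topological_abelian_group op.
Proof.
move=> opA opC op1 opV op_ball inv_ball; split=> //.
  move=> [x y] U /nbhs_set_type_ballP[d d0 dU].
  exists ([set x' : A | ball (set_val x) d (set_val x')],
          [set y' : A | ball (set_val y) d (set_val y')]).
    by split; apply/nbhs_set_type_ballP; exists d.
  by move=> [x' y'] [/= xx' yy']; apply: dU; exact: op_ball.
exists e, inv; split=> // x U /nbhs_set_type_ballP[d d0 dU].
apply/nbhs_set_type_ballP; exists d => // y xy; apply: dU; exact: inv_ball.
Qed.

(** The laws [f] and [g] are given on the whole of [Q_p], where associativity
and commutativity are polynomial identities; only invertibility and the
distance estimates depend on [A]. *)
Lemma padic_compact_group (p : nat) (p_pr : prime p) (A : set (padic p_pr))
    (f : padic p_pr -> padic p_pr -> padic p_pr) (e : padic p_pr)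
    (g : padic p_pr -> padic p_pr) :
  compact A ->
  (forall x y, A x -> A y -> A (f x y)) -> A e -> (forall x, A x -> A (g x)) ->
  associative f -> commutative f -> left_id e f ->
  (forall x, A x -> f (g x) x = e) ->
  (forall x x' y y', A x -> A x' -> A y -> A y' ->
    padic_norm (f x y - f x' y') <=
    Num.max (padic_norm (x - x')) (padic_norm (y - y'))) ->
  (forall x y, A x -> A y -> padic_norm (g x - g y) <= padic_norm (x - y)) ->
  exists op : A -> A -> A,
    (forall x y : A, set_val (op x y) = f (set_val x) (set_val y)) /\
    compact_topological_abelian_group op.
Proof.
move=> cA Af Ae Ag fA fC f1 fV f_le g_le.
pose inA z (Az : A z) : A := exist (fun z => z \in A) z (mem_set Az).
pose op (x y : A) : A := inA _ (Af _ _ (set_valP x) (set_valP y)).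
exists op; split=> //; split; last exact: compact_set_type.
pose inv (x : A) : A := inA _ (Ag _ (set_valP x)).
apply: (@nonexpansive_topological_group _ _ A op (inA _ Ae) inv).
- by move=> x y z; apply: val_inj; exact: fA.
- by move=> x y; apply: val_inj; exact: fC.
- by move=> x; apply: val_inj; exact: f1.
- by move=> x; apply: val_inj; exact/fV/set_valP.
- move=> d x x' y y' xx' yy'.
  apply: le_lt_trans (f_le _ _ _ _ _ _ _ _) _; try exact: set_valP.
  by rewrite gt_max; apply/andP; split.
- move=> d x y xy.
  by apply: le_lt_trans (g_le _ _ _ _) _; try exact: set_valP.
Qed.

Lemma subVf (F : fieldType) (x y : F) : x != 0 -> y != 0 ->
  x^-1 - y^-1 = x^-1 * y^-1 * (y - x).
Proof. by move=> x0 y0; field; rewrite x0 y0. Qed.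

Theorem theorem1 (p : nat) (p_pr : prime p) (a : padic p_pr) (r : rat)
    (r_pow : exists m : int, r = p%:R ^ m) :
  (exists op : padic_ball r a -> padic_ball r a -> padic_ball r a,
      (forall x y : padic_ball r a,
          set_val (op x y) = set_val x + set_val y - a) /\
      compact_topological_abelian_group op) /\
  (exists op : padic_sphere r a -> padic_sphere r a -> padic_sphere r a,
      (forall x y : padic_sphere r a,
          set_val (op x y) =
          ratr r * (set_val x - a) * (set_val y - a) + a) /\
      compact_topological_abelian_group op).
Proof.
case: r_pow => m rE; have p0 : 0 < p%:R :> rat by rewrite ltr0n prime_gt0.
have r0 : 0 < r by rewrite rE exprz_gt0.
split.
  apply: (@padic_compact_group p p_pr _ (fun x y => x + y - a) a
    (fun x => a + a - x)).
  - by rewrite rE; exact: padic_ball_compact.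
  - move=> x y xa ya; rewrite /padic_ball /=.
    have -> : x + y - a - a = (x - a) + (y - a) by ring.
    by apply: le_trans (padic_normD_max _ _) _; rewrite ge_max xa.
  - by rewrite /padic_ball /= subrr padic_norm0 ltW.
  - move=> x xa; rewrite /padic_ball /=.
    have -> : a + a - x - a = a - x by ring.
    by rewrite padic_norm_dist.
  - by move=> x y z; ring.
  - by move=> x y; ring.
  - by move=> x; ring.
  - by move=> x _; ring.
  - move=> x x' y y' _ _ _ _.
    have -> : x + y - a - (x' + y' - a) = (x - x') + (y - y') by ring.
    exact: padic_normD_max.
  - move=> x y _ _; have -> : a + a - x - (a + a - y) = y - x by ring.
    by rewrite padic_norm_dist.
have : padic_norm (ratr r : padic p_pr) = r^-1.
  by rewrite padic_norm_ratr rE padic_abs_exp// invr_expz.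
(* Only the norm of [ratr r] matters; abstracting it also keeps [padic_normM]
   from unfolding it into a quotient of integers. *)
move: (ratr r) => R RE.
have R0 : R != 0 by rewrite -padic_norm_gt0 RE invr_gt0.
have S0 x : padic_sphere r a x -> x - a != 0.
  by rewrite -padic_norm_gt0 => ->.
apply: (@padic_compact_group p p_pr _ (fun x y => R * (x - a) * (y - a) + a)
  (R^-1 + a) (fun x => R^-1 * R^-1 * (x - a)^-1 + a)).
- by rewrite rE; exact: padic_sphere_compact.
- move=> x y xa ya; rewrite /padic_sphere /= addrK !padic_normM RE xa ya.
  by rewrite mulVf ?mul1r// gt_eqF.
- by rewrite /padic_sphere /= addrK padic_normV RE invrK.
- move=> x xa; rewrite /padic_sphere /= addrK !padic_normM !padic_normV RE xa.
  by rewrite invrK mulfK// gt_eqF.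
- by move=> x y z; ring.
- by move=> x y; ring.
- by move=> x; rewrite addrK divff// mul1r subrK.
- move=> x /S0 xa; rewrite addrK !mulrA divff// mul1r mulfVK//.
- move=> x x' y y' _ x'a ya _.
  have -> : R * (x - a) * (y - a) + a - (R * (x' - a) * (y' - a) + a) =
      R * ((x - x') * (y - a)) + R * ((x' - a) * (y - y')) by ring.
  apply: le_trans (padic_normD_max _ _) _.
  rewrite !padic_normM RE x'a ya [_ * r]mulrC !mulrA mulVf ?gt_eqF//.
  by rewrite !mul1r.
- move=> x y xa ya.
  have -> : R^-1 * R^-1 * (x - a)^-1 + a - (R^-1 * R^-1 * (y - a)^-1 + a) =
      R^-1 * R^-1 * ((x - a)^-1 - (y - a)^-1) by rewrite mulrBr opprD addrACA subrr addr0.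
  rewrite subVf ?S0// !padic_normM !padic_normV RE xa ya invrK.
  rewrite !mulrA mulfK ?gt_eqF// divff ?gt_eqF// mul1r.
  by rewrite opprB addrA subrK padic_norm_dist.
Qed.
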